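(* Let $(\mathcal X,d)$ be a metric space with a regular Borel measure $\mu$ such that all balls defined by $d$ have finite and positive measure. The following statements are equivalent. (i) The triple $(\mathcal X,d,\mu)$ is an RD-space. (ii) The triple $(\mathcal X,d,\mu)$ is a space of homogeneous type and there exists a constant $a_0>1$ such that for all $x\in\mathcal X$ and $0<r<\operatorname{diam}(\mathcal X)/a_0$, $$B(x,a_0r)\setminus B(x,r)\neq\emptyset.$$ (iii) The triple $(\mathcal X,d,\mu)$ is a $(\kappa,n)$-space for some $0<\kappa\le n$, which means that there exist constants $C_1\ge1$ and $0<C_2\le1$ such that for all $x\in\mathcal X$, $0<r<2\operatorname{diam}(\mathcal X)$ and $1\le\lambda<2\operatorname{diam}(\mathcal X)/r$, $$\mu(B(x,\lambda r))\le C_1\lambda^n\mu(B(x,r))\qquad\text{and}\qquad\mu(B(x,\lambda r))\ge C_2\lambda^\kappa\mu(B(x,r)).$$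
   Context: $B(x,r)=\{y\in\mathcal X:d(x,y)<r\}$ and $\operatorname{diam}(\mathcal X)=\sup\{d(x,y):x,y\in\mathcal X\}\in[0,\infty]$. $(\mathcal X,d,\mu)$ is a space of homogeneous type if there is a constant $C_0\in(1,\infty)$ such that $\mu(B(x,2r))\le C_0\,\mu(B(x,r))$ for all $x\in\mathcal X$ and $r>0$. $(\mathcal X,d,\mu)$ is an RD-space if it is a space of homogeneous type and there exist constants $a_0,\widetilde C_0\in(1,\infty)$ such that $\mu(B(x,a_0r))\ge\widetilde C_0\,\mu(B(x,r))$ for all $x\in\mathcal X$ and $0<r<\operatorname{diam}(\mathcal X)/a_0$. *)

(* Defs.v *)
From HB Require Import structures.
From mathcomp Require Import all_boot all_order all_algebra.
From mathcomp Require Import all_classical all_reals all_analysis.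

Set Implicit Arguments.
Unset Strict Implicit.
Unset Printing Implicit Defensive.

Import Order.TTheory GRing.Theory Num.Theory.

Local Open Scope classical_set_scope.
Local Open Scope ring_scope.
Local Open Scope ereal_scope.

                                                                              
                            
#[short(type="pmetricType")]
HB.structure Definition PointedMetric (K : numDomainType) :=
  { M of Metric K M & Pointed M }.

Notation borelType X := (g_sigma_algebraType (@open X)).

Section diameter.
Context {R : realType} (X : pmetricType R).

Definition diam : \bar R :=
  ereal_sup [set (mdist p.1 p.2)%:E | p in [set: X * X]].

End diameter.

Section rd_spaces.
Context {R : realType} {X : pmetricType R}.
Implicit Types (mu : {measure set (borelType X) -> \bar R}).

                                                                               
                                                                           
                                                           
Definition regular_borel_measure mu := forall A : set (borelType X),
  measurable A ->
  mu A = ereal_inf [set mu U | U in [set U : set X | open U /\ A `<=` U]] /\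
  mu A = ereal_sup [set mu F | F in [set F : set X | closed F /\ F `<=` A]].

Definition finite_positive_balls mu := forall (x : X) (r : R), (0 < r)%R ->
  0 < mu (ball x r) < +oo.

Definition homogeneous_type mu := exists C0 : R, (1 < C0)%R /\
  forall (x : X) (r : R), (0 < r)%R ->
    mu (ball x (2 * r)%R) <= C0%:E * mu (ball x r).

Definition RD_space mu := homogeneous_type mu /\
  exists a0 C0' : R, [/\ (1 < a0)%R, (1 < C0')%R &
    forall (x : X) (r : R), (0 < r)%R -> r%:E < diam X / a0%:E ->
      mu (ball x (a0 * r)%R) >= C0'%:E * mu (ball x r)].

Definition kappa_n_space (kappa n : R) mu :=
  exists C1 C2 : R, [/\ (1 <= C1)%R, (0 < C2 <= 1)%R &
    forall (x : X) (r lambda : R),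
      (0 < r)%R -> r%:E < 2%:E * diam X ->
      (1 <= lambda)%R -> lambda%:E < 2%:E * diam X / r%:E ->
      mu (ball x (lambda * r)%R) <= (C1 * lambda `^ n)%:E * mu (ball x r) /\
      mu (ball x (lambda * r)%R) >= (C2 * lambda `^ kappa)%:E * mu (ball x r)].

End rd_spaces.

(* Main.v *)
Require Import Defs.
From mathcomp Require Import all_boot all_order all_algebra.
From mathcomp Require Import all_classical all_reals all_analysis.
From mathcomp Require Import ring lra.

(** All balls have finite positive measure, so the three conditions concern
the positive real function [ball_vol mu x r], nondecreasing in [r].

RD-spaces have nonempty annuli: if the larger of two concentric balls has
strictly more mass, it cannot be contained in the smaller one
([annuli_of_RD_space]).

Nonempty annuli give power bounds: iterating the doubling inequality over
powers of 2 gives the upper power bound, with the exponent [log C0 / log 2]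
([doubling_growth]). For the lower one, a point [y] of the annulus [ball x (2
a0 r) \ ball x (2 r)] yields a ball of radius [r] disjoint from [ball x r] and
contained with it in [ball x ((2 a0 + 1) r)]; by doubling its mass is at least
a fixed fraction of that of [ball x r]. So enlarging the radius by [a = 2 a0 +
1] multiplies the mass by at least a constant [c > 1]
([reverse_doubling_of_annuli]), as long as the enlarged radius stays below the
diameter. Iterating over powers of [a] gives the exponent [log c / log a]
([reverse_doubling_growth]). The last steps of the iteration may leave the
range of radii where this holds; they cost a factor [c ^ 2], absorbed by the
constant.

Power bounds give an RD-space: the upper bound for the factor 2 is the
doubling inequality at radii below the diameter. A ball of radius larger than
the diameter is the whole space, which settles the larger radii; the radius
equal to the diameter is compared with a slightly smaller one
([homogeneous_type_of_kappa_n_space]). The lower bound at a factor [a] so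
large that [C2 a ^ kappa = 2] is the reverse doubling inequality
([RD_space_of_kappa_n_space]). *)

Set Implicit Arguments.
Unset Strict Implicit.

Import Order.TTheory GRing.Theory Num.Theory.

Local Open Scope classical_set_scope.
Local Open Scope ring_scope.
Local Open Scope ereal_scope.

(** * Induction on scales and real powers *)

(** Dividing by [a] a number larger than [b] decreases it by at least
[b (1 - 1 / a)], so finitely many divisions lead into [[1, b]].  This replaces
the choice of the integer [m] with [a ^ m <= l < a ^ (m + 1)] in iterations of
doubling inequalities. *)
Lemma scale_induction (R : realType) (a b : R) (P : R -> Prop) :
  (1 < a)%R -> (a <= b)%R ->
  (forall l : R, (1 <= l <= b)%R -> P l) ->
  (forall l : R, (b < l)%R -> P (l / a)%R -> P l) ->
  forall l : R, (1 <= l)%R -> P l.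
Proof.
move=> a1 ab Pbase Pstep l l1.
have a0 : (0 < a)%R by lra.
pose e : R := (b * (1 - a^-1))%R.
have ia1 : (a^-1 < 1)%R by rewrite invf_lt1.
have e0 : (0 < e)%R by rewrite mulr_gt0//; lra.
have upto k : forall s, (1 <= s)%R -> (s <= b + k%:R * e)%R -> P s.
  elim: k => [|k IHk] s s1 sk; first by apply: Pbase; rewrite s1; lra.
  case: (lerP s b) => [sb|bs]; first by apply: Pbase; rewrite s1.
  apply: Pstep => //; apply: IHk; first by rewrite ler_pdivlMr//; lra.
  have : (b * (1 - a^-1) <= s * (1 - a^-1))%R by rewrite ler_wpM2r//; lra.
  rewrite -/e => es; move: sk; rewrite -natr1; lra.
have /archi_boundP := divr_ge0 (le_trans ler01 l1) (ltW e0).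
set N := Num.bound _; rewrite ltr_pdivrMr// => /ltW le.
by apply: (upto N) => //; rewrite (le_trans le)// lerDr; lra.
Qed.

Lemma powR_log (R : realType) (a c : R) :
  (1 < a)%R -> (1 < c)%R -> exists2 k : R, (0 < k)%R & (a `^ k = c)%R.
Proof.
move=> a1 c1; exists (ln c / ln a)%R; first by rewrite divr_gt0// ln_gt0.
have lna := ln_gt0 a1.
rewrite /powR gt_eqF; last lra.
by rewrite divfK ?gt_eqF// lnK// posrE; lra.
Qed.

Lemma powR_ge1 (R : realType) (a x : R) :
  (1 <= a)%R -> (0 <= x)%R -> (1 <= a `^ x)%R.
Proof. by move=> a1 x0; rewrite -(powRr0 a) ler_powR. Qed.

Lemma powR_gt1 (R : realType) (a x : R) :
  (1 < a)%R -> (0 < x)%R -> (1 < a `^ x)%R.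
Proof.
move=> a1 x0; have {1}<- : (1 `^ x = 1 :> R)%R by rewrite powR1.
by rewrite gt0_ltr_powR// nnegrE; lra.
Qed.

Lemma powR_le_l (R : realType) (a b x : R) :
  (0 <= a)%R -> (a <= b)%R -> (0 <= x)%R -> (a `^ x <= b `^ x)%R.
Proof.
by move=> a0 ab x0; rewrite ge0_ler_powR// ?nnegrE// (le_trans a0).
Qed.

(** * Power growth from one-step inequalities *)

Section growth.
Context {R : realType} (f : R -> R).
Hypothesis f_ge0 : forall r : R, (0 < r)%R -> (0 <= f r)%R.
Hypothesis f_homo : forall r s : R, (0 < r)%R -> (r <= s)%R -> (f r <= f s)%R.

(** Each halving of [l] costs a factor [C], and [2 ^ n >= C] pays for it. *)
Lemma doubling_growth (C n : R) : (0 <= n)%R -> (0 <= C <= 2 `^ n)%R ->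
  (forall r : R, (0 < r)%R -> (f (2 * r) <= C * f r)%R) ->
  forall l r : R, (1 <= l)%R -> (0 < r)%R ->
    (f (l * r) <= C * l `^ n * f r)%R.
Proof.
move=> n0 /andP[C0 Cn] dbl l r l1; move: r.
move: l l1; apply: (@scale_induction _ 2 2); [lra|lra| |] => l.
  move=> /andP[l1 l2] r r0.
  apply: (le_trans (@f_homo (l * r)%R (2 * r)%R _ _)).
  - by apply: mulr_gt0 => //; lra.
  - by rewrite ler_wpM2r// ltW.
  apply: le_trans (dbl _ r0) _; rewrite ler_wpM2r ?f_ge0//.
  by rewrite ler_peMr// powR_ge1.
move=> l2 IH r r0.
have r20 : (0 < 2 * r)%R by lra.
have := IH _ r20; rewrite (_ : l / 2 * (2 * r) = l * r)%R; last by field.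
move=> /le_trans; apply.
have l20 : (0 <= l / 2)%R by lra.
apply: (@le_trans _ _ (C * (l / 2) `^ n * (C * f r))%R).
  by rewrite ler_wpM2l ?mulr_ge0 ?powR_ge0// dbl.
have -> : (l `^ n = 2 `^ n * (l / 2) `^ n)%R.
  by rewrite -powRM//; congr (_ `^ _)%R; field.
have -> : (C * (l / 2) `^ n * (C * f r) = C * (l / 2) `^ n * f r * C)%R by ring.
have -> : (C * (2 `^ n * (l / 2) `^ n) * f r =
  C * (l / 2) `^ n * f r * 2 `^ n)%R by ring.
by rewrite ler_wpM2l// !mulr_ge0 ?powR_ge0 ?f_ge0.
Qed.

(** The one-step inequality is known only up to the scale [D], whereas the
conclusion is needed up to [2 D].  For [l > a ^ 2] the first step from [r] to
[a r] stays below [D], since [a (a r) < l r < 2 D <= a D]; for [l <= a ^ 2] the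
factor [C ^- 2] makes the bound follow from monotonicity alone. *)
Lemma reverse_doubling_growth (D : \bar R) (a C k : R) :
  (2 <= a)%R -> (0 < k)%R -> (a `^ k = C)%R ->
  (forall r : R, (0 < r)%R -> (a * r)%:E < D -> (C * f r <= f (a * r))%R) ->
  forall l r : R, (1 <= l)%R -> (0 < r)%R -> (l * r)%:E < 2%:E * D ->
    (C ^- 2 * l `^ k * f r <= f (l * r))%R.
Proof.
move=> a2 k0 akC rdbl l r l1; move: r.
have a0 : (0 < a)%R by lra.
have C0 : (0 < C)%R by rewrite -akC powR_gt0.
move: l l1; apply: (@scale_induction _ a (a ^+ 2));
  [lra|by rewrite expr2; nra| |] => l.
  move=> /andP[l1 la] r r0 _.
  apply: (@le_trans _ _ (f r)); last by rewrite f_homo// ler_peMl// ltW.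
  rewrite ler_piMl ?f_ge0// mulrC ler_pdivrMr ?exprn_gt0// mul1r.
  rewrite -akC -powR_mulrn ?powR_ge0// -powRrM mulrC powRrM.
  rewrite powR_mulrn ?(ltW a0)//.
  by apply: powR_le_l; lra.
move=> al IH r r0 lrD.
have l0 : (0 < l)%R by apply: lt_trans al; rewrite exprn_gt0.
have ar0 : (0 < a * r)%R by rewrite mulr_gt0.
have lar : (l / a * (a * r) = l * r)%R by field; rewrite gt_eqF.
have arD : (a * r)%:E < D.
  rewrite -(@lte_pmul2l _ 2%:E)// ?lte_fin//; apply: le_lt_trans lrD.
  rewrite -EFinM lee_fin mulrA ler_wpM2r ?ltW//.
  by apply: le_lt_trans al; rewrite expr2 ler_wpM2r// ltW.
have := IH _ ar0; rewrite lar => /(_ lrD); apply: le_trans.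
have la0 : (0 <= l / a)%R by rewrite divr_ge0 ?ltW.
apply: (@le_trans _ _ (C ^- 2 * (l / a) `^ k * (C * f r))%R); last first.
  by rewrite ler_wpM2l ?rdbl// mulr_ge0 ?powR_ge0// invr_ge0 exprn_ge0// ltW.
(* The factor [C] gained from [r] to [a r] is the one lost from [l] to
   [l / a]. *)
have -> : (l `^ k = C * (l / a) `^ k)%R.
  rewrite -akC -powRM ?(ltW a0)//; congr (_ `^ _)%R.
  by field; rewrite gt_eqF.
by rewrite le_eqVlt; apply/orP; left; apply/eqP; field; rewrite gt_eqF.
Qed.

End growth.

(** * Balls and diameter *)

Section metric_balls.
Context {R : realType} {X : pmetricType R}.

Lemma metric_ball_open (x : X) (r : R) : open (ball x r).
Proof.
rewrite openE => y; rewrite ballEmdist/= => xyr.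
rewrite /interior -nbhs_ballE; exists (r - mdist x y)%R => /=.
  by rewrite subr_gt0.
move=> z; rewrite !ballEmdist/= ltrBrDl; apply: le_lt_trans.
exact: metric_triangle.
Qed.

Lemma mdist_le_diam (x y : X) : (mdist x y)%:E <= diam X.
Proof. by apply: ereal_sup_ubound => /=; exists (x, y). Qed.

Lemma diam_ge0 : 0 <= diam X.
Proof.
by apply: le_trans (mdist_le_diam point point); rewrite lee_fin mdist_ge0.
Qed.

Lemma ball_diam (x : X) (r : R) : diam X < r%:E -> ball x r = setT.
Proof.
move=> Dr; apply/seteqP; split=> // y _; rewrite ballEmdist/= -lte_fin.
exact: le_lt_trans (mdist_le_diam _ _) Dr.
Qed.

Lemma lt_diam_div (a r : R) : (0 < a)%R ->
  (r%:E < diam X / a%:E) = ((a * r)%:E < diam X).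
Proof.
by move=> a0; rewrite inver gt_eqF// lte_pdivlMr// -EFinM mulrC.
Qed.

End metric_balls.

(** * Volume of balls *)

Definition ball_vol {R : realType} {X : pmetricType R}
  (mu : {measure set (borelType X) -> \bar R}) (x : X) (r : R) : R :=
  fine (mu (ball x r)).

Section ball_volume.
Context {R : realType} {X : pmetricType R}.
Context {mu : {measure set (borelType X) -> \bar R}}.
Hypothesis hballs : finite_positive_balls mu.
Local Notation V := (ball_vol mu).

Lemma measurable_ball_borel (x : X) (r : R) :
  measurable (ball x r : set (borelType X)).
Proof. by apply: sub_sigma_algebra; exact: metric_ball_open. Qed.

Lemma ball_volE (x : X) (r : R) : (0 < r)%R -> mu (ball x r) = (V x r)%:E.
Proof.
move=> r0; have /andP[m0 moo] := @hballs x r r0.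
by rewrite fineK// ge0_fin_numE// ltW.
Qed.

Lemma ball_vol_gt0 (x : X) (r : R) : (0 < r)%R -> (0 < V x r)%R.
Proof.
by move=> r0; rewrite -lte_fin -ball_volE//; case/andP: (@hballs x r r0).
Qed.

Lemma ball_vol_subset (x y : X) (r s : R) : (0 < r)%R -> (0 < s)%R ->
  ball x r `<=` ball y s -> (V x r <= V y s)%R.
Proof.
move=> r0 s0 rs; rewrite -lee_fin -!ball_volE//.
by apply: le_measure; rewrite ?inE//; exact: measurable_ball_borel.
Qed.

Lemma ball_vol_homo (x : X) (r s : R) : (0 < r)%R -> (r <= s)%R ->
  (V x r <= V x s)%R.
Proof.
move=> r0 rs; apply: ball_vol_subset => //; first exact: lt_le_trans rs.
exact: le_ball.
Qed.

Lemma ball_vol_disjoint (x y z : X) (r s t : R) :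
  (0 < r)%R -> (0 < s)%R -> (0 < t)%R ->
  ball x r `&` ball y s = set0 ->
  ball x r `<=` ball z t -> ball y s `<=` ball z t ->
  (V x r + V y s <= V z t)%R.
Proof.
move=> r0 s0 t0 dis xz yz; rewrite -lee_fin EFinD -!ball_volE//.
have mB := measurable_ball_borel.
rewrite -(measureU mu (mB x r) (mB y s) dis).
by apply: le_measure; rewrite ?inE//; [exact: measurableU|rewrite subUset].
Qed.

Lemma homogeneous_typeP : homogeneous_type mu <->
  exists2 C : R, (1 < C)%R &
    forall (x : X) (r : R), (0 < r)%R -> (V x (2 * r) <= C * V x r)%R.
Proof.
split=> [[C [C1 H]]|[C C1 H]]; exists C => //.
  by move=> x r r0; have := H x r r0; rewrite !ball_volE// ?mulr_gt0.
by split=> // x r r0; rewrite !ball_volE ?mulr_gt0// -EFinM lee_fin H.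
Qed.

Lemma homogeneous_growth : homogeneous_type mu ->
  exists C n : R, [/\ (1 <= C)%R, (0 < n)%R &
    forall (x : X) (l r : R), (1 <= l)%R -> (0 < r)%R ->
      (V x (l * r) <= C * l `^ n * V x r)%R].
Proof.
move=> /homogeneous_typeP[C C1 dbl].
have [n n0 Cn] := @powR_log R 2 C (ltr1n R 2) C1.
exists C, n; split=> [||x]; [exact: ltW|by []|].
apply: doubling_growth => //; [| |exact: ltW| |exact: dbl].
- by move=> r r0; rewrite ltW// ball_vol_gt0.
- by move=> r s; exact: ball_vol_homo.
- by rewrite Cn lexx andbT; lra.
Qed.

(** A point [y] with [2 r <= mdist x y < 2 a0 r] has a ball of radius [r]
disjoint from [ball x r], and each of the two balls lies in the ball of radius
[(2 a0 + 1) r] about the centre of the other.  Hence the mass of [ball y r] is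
both gained on top of that of [ball x r] and, by doubling, comparable to it. *)
Lemma reverse_doubling_of_annuli (a0 : R) : homogeneous_type mu -> (1 < a0)%R ->
  (forall (x : X) (r : R), (0 < r)%R -> (a0 * r)%:E < diam X ->
    ball x (a0 * r)%R `\` ball x r !=set0) ->
  exists2 C : R, (1 < C)%R &
    forall (x : X) (r : R), (0 < r)%R -> ((2 * a0 + 1) * r)%:E < diam X ->
      (C * V x r <= V x ((2 * a0 + 1) * r))%R.
Proof.
move=> /homogeneous_growth[C [n [C1 n0 gr]]] a1 ann.
set a := (2 * a0 + 1)%R.
have a0' : (1 <= a)%R by rewrite /a; lra.
pose K := (C * a `^ n)%R.
have K0 : (0 < K)%R by rewrite mulr_gt0 ?powR_gt0//; lra.
exists (1 + K^-1)%R; first by rewrite ltrDl invr_gt0.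
move=> x r r0 arD.
have ar0 : (0 < a * r)%R by rewrite mulr_gt0//; lra.
(* The annulus starts at radius [2 r] to make the two balls of radius [r]
   disjoint. *)
have [|y [xya xyr]] := ann x (2 * r)%R (mulr_gt0 (ltr0n R 2) r0).
  by apply: le_lt_trans arD; rewrite lee_fin /a mulrDl mul1r; lra.
move: xya xyr; rewrite !ballEmdist/= => xya /negP; rewrite -leNgt => xyr.
have Vx : (V x r <= K * V y r)%R.
  apply: le_trans (gr _ _ _ a0' r0); apply: ball_vol_subset => // z.
  rewrite !ballEmdist/= => xz.
  apply: le_lt_trans (metric_triangle y x z) _; rewrite (metric_sym y x).
  by rewrite /a mulrDl mul1r; lra.
have dis := @ball_vol_disjoint x y x r r (a * r)%R r0 r0 ar0.
apply: le_trans (dis _ _ _).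
- by rewrite [leLHS]mulrDl mul1r lerD2l ler_pdivrMl.
- rewrite -subset0 => z []; rewrite !ballEmdist/= => xz yz.
  have := metric_triangle x z y; rewrite (metric_sym z y); lra.
- by apply: le_ball; rewrite ler_peMl// ltW.
- move=> z; rewrite !ballEmdist/= => yz.
  apply: le_lt_trans (metric_triangle x y z) _.
  by rewrite /a mulrDl mul1r; lra.
Qed.

End ball_volume.

(** * The implications between the three conditions *)

Section equivalence.
Context {R : realType} {X : pmetricType R}.
Context {mu : {measure set (borelType X) -> \bar R}}.
Hypothesis hballs : finite_positive_balls mu.
Local Notation V := (ball_vol mu).

(** The two bounds on the radii in the definition amount to the single one on
[l * r], because [1 <= l]. *)
Lemma kappa_n_spaceP (kappa n : R) : kappa_n_space kappa n mu <->
  exists C1 C2 : R, [/\ (1 <= C1)%R, (0 < C2 <= 1)%R &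
    forall (x : X) (l r : R), (1 <= l)%R -> (0 < r)%R ->
      (l * r)%:E < 2%:E * diam X ->
      (V x (l * r) <= C1 * l `^ n * V x r)%R /\
      (C2 * l `^ kappa * V x r <= V x (l * r))%R].
Proof.
split=> [][C1 [C2 [C11 C201 H]]]; exists C1, C2; split=> //.
  move=> x l r l1 r0 lrD; have lr0 : (0 < l * r)%R by rewrite mulr_gt0//; lra.
  have := H x r l r0 _ l1; rewrite inver gt_eqF// lte_pdivlMr// -EFinM.
  rewrite !(ball_volE hballs)// -!EFinM !lee_fin; apply=> //.
  by apply: le_lt_trans lrD; rewrite lee_fin ler_peMl// ltW.
move=> x r l r0 _ l1; rewrite inver gt_eqF// lte_pdivlMr// -EFinM => lrD.
have lr0 : (0 < l * r)%R by rewrite mulr_gt0//; lra.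
by rewrite !(ball_volE hballs)// -!EFinM !lee_fin; exact: H.
Qed.

Lemma annuli_of_RD_space : RD_space mu ->
  exists a0 : R, (1 < a0)%R /\
    forall (x : X) (r : R), (0 < r)%R -> r%:E < diam X / a0%:E ->
      ball x (a0 * r)%R `\` ball x r !=set0.
Proof.
move=> [_ [a0 [C [a1 C1 RD]]]]; exists a0; split=> // x r r0 rD.
have ar0 : (0 < a0 * r)%R by rewrite mulr_gt0//; lra.
apply/set0P/negP => /eqP; rewrite setD_eq0 => sub.
have := RD x r r0 rD; rewrite !(ball_volE hballs)// -EFinM lee_fin leNgt.
move=> /negP; apply; apply: le_lt_trans (ball_vol_subset hballs ar0 r0 sub) _.
by rewrite ltr_pMl// ball_vol_gt0.
Qed.

(** The two exponents come from unrelated constants; taking the larger one as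
[n] ensures [kappa <= n] and only weakens the upper bound. *)
Lemma kappa_n_space_of_annuli (a0 : R) : homogeneous_type mu -> (1 < a0)%R ->
  (forall (x : X) (r : R), (0 < r)%R -> (a0 * r)%:E < diam X ->
    ball x (a0 * r)%R `\` ball x r !=set0) ->
  exists kappa n : R, (0 < kappa <= n)%R /\ kappa_n_space kappa n mu.
Proof.
move=> hom a1 ann.
have [C [n [C1 n0 up]]] := homogeneous_growth hballs hom.
have [c c1 rdbl] := reverse_doubling_of_annuli hballs hom a1 ann.
have [k k0 ac] := @powR_log R (2 * a0 + 1) c ltac:(lra) c1.
exists k, (Num.max k n); split; first by rewrite k0 le_max lexx.
apply/kappa_n_spaceP; exists C, (c ^- 2)%R; split=> //.
  by rewrite invr_gt0 invf_le1 ?exprn_ege1 ?exprn_gt0//; lra.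
move=> x l r l1 r0 lrD; split.
  apply: le_trans (up x l r l1 r0) _.
  rewrite ler_wpM2r ?(ltW (ball_vol_gt0 hballs _ r0))//.
  rewrite ler_wpM2l ?(le_trans ler01 C1)//.
  by rewrite ler_powR// le_max lexx orbT.
apply: (@reverse_doubling_growth _ (V x) _ _ (diam X) (2 * a0 + 1)) => //.
- by move=> s s0; rewrite ltW// ball_vol_gt0.
- by move=> s t; exact: ball_vol_homo.
- lra.
- by move=> s; exact: rdbl.
Qed.

(** Doubling is required at all radii, but the growth bounds give it only below
the diameter.  At a larger radius both balls are the whole space.  At a radius
[r] equal to the diameter, the ball of radius [2 r] is still the whole space,
hence equal to the one of radius [2 (3 / 4 r)], and doubling applies at
[3 / 4 r]. *)
Lemma homogeneous_type_of_kappa_n_space (kappa n : R) :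
  (0 < n)%R -> kappa_n_space kappa n mu -> homogeneous_type mu.
Proof.
move=> n0 /kappa_n_spaceP[C1 [C2 [C11 _ kn]]].
pose C := (C1 * 2 `^ n)%R.
have C_gt1 : (1 < C)%R.
  apply: (lt_le_trans (powR_gt1 (ltr1n R 2) n0)).
  by rewrite ler_peMl// powR_ge0.
have below (x : X) (r : R) : (0 < r)%R -> r%:E < diam X ->
    (V x (2 * r) <= C * V x r)%R.
  move=> r0 rD; apply: (kn x 2%R r _ r0 _).1; first by rewrite ler1n.
  by rewrite EFinM lte_pmul2l// lte_fin.
apply/(homogeneous_typeP hballs); exists C => // x r r0.
have V0 (s : R) : (0 < s)%R -> (0 <= V x s)%R.
  by move=> /(ball_vol_gt0 hballs x)/ltW.
have [|Dr] := ltP r%:E (diam X); first exact: below.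
have whole (s : R) : (r < s)%R -> ball x s = setT.
  by move=> rs; apply: ball_diam; apply: le_lt_trans Dr _; rewrite lte_fin.
have [Dr'|] := ltP (diam X) r%:E.
  rewrite /ball_vol whole; last lra.
  by rewrite -(ball_diam x Dr') ler_peMl ?V0// ltW.
move=> rD.
have -> : V x (2 * r) = V x (2 * (3 / 4 * r)).
  by rewrite /ball_vol !whole//; lra.
apply: le_trans (below _ _ _ _) _.
- lra.
- by apply: lt_le_trans rD; rewrite lte_fin; lra.
- rewrite ler_wpM2l ?(ltW (lt_trans ltr01 C_gt1))//.
  by apply: ball_vol_homo => //; lra.
Qed.

Lemma RD_space_of_kappa_n_space (kappa n : R) :
  (0 < kappa <= n)%R -> kappa_n_space kappa n mu -> RD_space mu.
Proof.
move=> /andP[k0 kn] H; split.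
  by apply: homogeneous_type_of_kappa_n_space H; exact: lt_le_trans kn.
move: H => /kappa_n_spaceP[C1 [C2 [_ /andP[C20 C21] low]]].
have c1 : (1 < 2 / C2)%R by rewrite ltr_pdivlMr//; lra.
pose a := ((2 / C2) `^ kappa^-1)%R.
have a1 : (1 < a)%R by rewrite powR_gt1// invr_gt0.
have Ca : (C2 * a `^ kappa = 2)%R.
  rewrite -powRrM mulVf ?gt_eqF// powRr1; last lra.
  by rewrite mulrC divfK ?gt_eqF.
exists a, 2%R; split=> //; first by rewrite ltr1n.
move=> x r r0; rewrite lt_diam_div; last lra.
move=> arD.
have ar0 : (0 < a * r)%R by rewrite mulr_gt0//; lra.
rewrite !(ball_volE hballs)// -EFinM lee_fin -Ca.
apply: (low x a r _ r0 _).2; first exact: ltW.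
apply: lt_le_trans arD _.
by rewrite -[leLHS]mul1e lee_wpmul2r ?diam_ge0// lee_fin ler1n.
Qed.

End equivalence.

Theorem proposition2p1 (R : realType) (X : pmetricType R)
    (mu : {measure set (borelType X) -> \bar R})
    (hreg : regular_borel_measure mu)
    (hballs : finite_positive_balls mu) :
  [<-> RD_space mu;
       homogeneous_type mu /\
       exists a0 : R, (1 < a0)%R /\
         forall (x : X) (r : R), (0 < r)%R -> r%:E < diam X / a0%:E ->
           ball x (a0 * r)%R `\` ball x r !=set0;
       exists kappa n : R, (0 < kappa <= n)%R /\ kappa_n_space kappa n mu].
Proof.
tfae.
- by move=> RD; split; [exact: RD.1|exact: annuli_of_RD_space hballs RD].
- move=> [hom [a0 [a1 ann]]].
  apply: (kappa_n_space_of_annuli hballs hom a1) => x r r0 rD.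
  by apply: ann => //; rewrite lt_diam_div//; lra.
- move=> [kappa [n [kn H]]].
  by have := RD_space_of_kappa_n_space hballs kn H.
Qed.
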